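(* Let $w=(n,m)$ with $n\ge 2$ and $m\ge 1$ integers (i.e. $w=a(n,m)$, $n$ of either parity). Then the shadow $\mathrm{Sh}(w)$ of $w$ with respect to the trivial orientation is the convex hull of the following six alcoves: \begin{align*} &(n,\,m),\\ &(3-n+\epsilon_n,\;n+m-3+\epsilon_n),\\ &(3-n-m-\epsilon_n+\epsilon_m,\;n-2-\epsilon_n-\epsilon_m),\\ &(n+1,\;m-2),\\ &(2-n-\epsilon_n,\;n+m-1-\epsilon_n),\\ &(2-n-m-\epsilon_n+\epsilon_m,\;n-\epsilon_n-\epsilon_m). \end{align*} Here the convex hull of a set of alcoves means the set of all alcoves whose barycentre lies in the Euclidean convex hull of the barycentres of the given alcoves.
   Context: $W=\langle s_0,s_1,s_2\mid s_i^2=1,(s_0s_1)^3=(s_0s_2)^3=(s_1s_2)^3=1\rangle$ is the Coxeter group of type $\tilde A_2$. Subscripts of generators are read modulo 3. For $k\ge 0$, $\gamma_i(k)=s_is_{i+1}s_{i+2}\cdots$ ($k$ letters, subscripts increasing by one mod 3) and $\delta_i(k)=s_is_{i-1}s_{i-2}\cdots$ ($k$ letters, subscripts decreasing by one mod 3). Put $\epsilon_k=1$ if $k$ is odd and $\epsilon_k=0$ if $k$ is even. Geometry: let $E=\{v\in\mathbb R^3: v_1+v_2+v_3=0\}$ with the standard inner product, and let $\alpha,\beta$ be simple roots of the root system of type $A_2$ in $E$ ($\langle\alpha,\alpha\rangle=\langle\beta,\beta\rangle=2$, $\langle\alpha,\beta\rangle=-1$). For a root $\gamma$ and $k\in\mathbb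 Z$ let $H_{\gamma,k}=\{x:\langle x,\gamma\rangle=k\}$. $W$ acts on $E$ by affine reflections: $s_2,s_1,s_0$ are the reflections in $H_{\alpha,0},H_{\beta,0},H_{\alpha+\beta,1}$. The identity alcove is the triangle $A_0=\{x:\langle x,\alpha\rangle\ge0,\langle x,\beta\rangle\ge0,\langle x,\alpha+\beta\rangle\le1\}$, and $w\in W$ is identified with the alcove $wA_0$; these alcoves tile the plane $E$ by equilateral triangles. Coordinates: for $(n,m)\in\mathbb Z^2$ the alcove $(n,m)$ is the element $a(n,m)=b(n)\,c(n,m)\in W$, where $b(n)=\gamma_0(n)$ if $n\ge 0$, $b(n)=\delta_2(-n)$ if $n<0$, and $c(n,m)=\delta_{n+1}(m)$ if $m\ge 0$, $c(n,m)=\gamma_{n+2}(-m)$ if $m<0$. Both parities of $n$ are allowed; each element has exactly one pair of coordinates with $n$ even and exactly one with $n$ odd. Shadow: for $w\in W$ with reduced word $s_{i_1}\cdots s_{i_r}$, $\mathrm{Sh}(w)$ is the set of end alcoves $c_r$ of all (possibly folded) galleries $c_0=1,c_1,\dots,c_r$ with $c_t\in\{c_{t-1},c_{t-1}s_{i_t}\}$ for each $t$. It does not depend on the reduced word and equals the Bruhat interval $[1,w]$. *)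

(* Defs.v *)
From HB Require Import structures.
From mathcomp Require Import all_boot all_order all_algebra.
From mathcomp Require Import generic_quotient ring lra.
From mathcomp Require Import boolp classical_sets reals.

Set Implicit Arguments.
Unset Strict Implicit.
Unset Printing Implicit Defensive.

Import Order.TTheory GRing.Theory Num.Theory.
Local Open Scope classical_set_scope.
Local Open Scope ring_scope.
Local Open Scope quotient_scope.

(** * The Coxeter group of affine type A2

    The presented group is the quotient of the monoid of words in the
    generators by the least congruence containing the relators; it is a group
    because the generators are involutions.  Generators are indexed by ['Z_3],
    so arithmetic on subscripts is modulo 3. *)

Notation word := (seq 'Z_3).

Inductive cox_rel : word -> word -> Prop :=
| cox_refl u : cox_rel u u
| cox_sym u v : cox_rel u v -> cox_rel v u
| cox_trans v u w : cox_rel u v -> cox_rel v w -> cox_rel u w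
| cox_cat u u' v v' :
    cox_rel u u' -> cox_rel v v' -> cox_rel (u ++ v) (u' ++ v')
| cox_invol i : cox_rel [:: i; i] [::]
| cox_braid i j : i != j -> cox_rel [:: i; j; i; j; i; j] [::].

Definition cox_eq : rel word := fun u v => `[< cox_rel u v >].

Lemma cox_eq_equiv : equiv_class_of cox_eq.
Proof.
split=> [u|u v|v u w].
- exact/asboolP/cox_refl.
- by apply/asboolP/asboolP => /cox_sym.
- move=> /asboolP uv /asboolP vw; exact/asboolP/(cox_trans uv vw).
Qed.

Canonical cox_eq_rel := EquivRelPack cox_eq_equiv.

Definition W := {eq_quot cox_eq}.

HB.instance Definition _ := Choice.on W.
HB.instance Definition _ := EqQuotient.on W.

Definition eval (u : word) : W := \pi_W u.

Lemma evalP u v : eval u = eval v <-> cox_rel u v.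
Proof. by split=> [/eqmodP/asboolP //|uv]; apply/eqmodP/asboolP. Qed.

Lemma cox_repr (u : word) : cox_rel (repr (eval u)) u.
Proof. by apply/evalP; rewrite /eval reprK. Qed.

Lemma cox_rev u v : cox_rel u v -> cox_rel (rev u) (rev v).
Proof.
elim=> {u v} [u|u v _|v u w _ + _|u u' v v' _ hu _ hv|i|i j ij].
- exact: cox_refl.
- exact: cox_sym.
- exact: cox_trans.
- by rewrite !rev_cat; apply: cox_cat.
- exact: cox_invol.
- by apply: cox_braid; rewrite eq_sym.
Qed.

Lemma cox_rev_catl u : cox_rel (rev u ++ u) [::].
Proof.
elim: u => [|i u IH]; first exact: cox_refl.
rewrite rev_cons cat_rcons; apply: (cox_trans _ IH).
rewrite -[i :: i :: u]/([:: i; i] ++ u).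
apply: cox_cat; first exact: cox_refl.
by rewrite -{2}[u]cat0s; apply: cox_cat (cox_invol i) (cox_refl u).
Qed.

Lemma cox_rev_catr u : cox_rel (u ++ rev u) [::].
Proof. by rewrite -{1}[u]revK; apply: cox_rev_catl. Qed.

Definition mulW (x y : W) : W := eval (repr x ++ repr y).
Definition oneW : W := eval [::].
Definition invW (x : W) : W := eval (rev (repr x)).

Lemma eval_catE u v : mulW (eval u) (eval v) = eval (u ++ v).
Proof. by apply/evalP/cox_cat; apply: cox_repr. Qed.

Lemma evalK (x : W) : eval (repr x) = x. Proof. exact: reprK. Qed.

Lemma mulWA : associative mulW.
Proof.
by move=> x y z; rewrite -[x]evalK -[y]evalK -[z]evalK !eval_catE catA.
Qed.

Lemma mul1W : left_id oneW mulW.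
Proof. by move=> x; rewrite -[x]evalK /oneW eval_catE. Qed.

Lemma mulW1 : right_id oneW mulW.
Proof. by move=> x; rewrite -[x]evalK /oneW eval_catE cats0. Qed.

Lemma mulVW : left_inverse oneW invW mulW.
Proof.
move=> x; rewrite -{2}[x]evalK /invW eval_catE.
exact/evalP/cox_rev_catl.
Qed.

Lemma mulWV : right_inverse oneW invW mulW.
Proof.
move=> x; rewrite -{1}[x]evalK /invW eval_catE.
exact/evalP/cox_rev_catr.
Qed.

HB.instance Definition _ := isGroup.Build W mulWA mul1W mulW1 mulVW mulWV.

Lemma eval_cat u v : eval (u ++ v) = (eval u * eval v)%g.
Proof. by rewrite -eval_catE. Qed.

Definition s (i : 'Z_3) : W := eval [:: i].

Lemma eval_prod u : eval u = (\prod_(i <- u) s i)%g.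
Proof.
elim: u => [|i u IH]; first by rewrite big_nil.
by rewrite big_cons -IH -eval_cat.
Qed.

Definition reduced (u : word) : Prop :=
  forall v : word, eval v = eval u -> (size u <= size v)%N.

(** * Shadow for the trivial orientation *)

(** [v] is the end alcove of a possibly folded gallery of type [u] from [1]. *)
Definition gallery_end (u : word) (v : W) : Prop :=
  exists c : nat -> W,
    [/\ c 0%N = 1%g,
        forall t, (t < size u)%N ->
          c t.+1 = c t \/ c t.+1 = (c t * s (nth 0 u t))%g
      & c (size u) = v].

Definition Sh (w : W) : set W :=
  [set v | exists u : word, [/\ reduced u, eval u = w & gallery_end u v]].

(** * Coordinates *)

Definition gamma (i : 'Z_3) (k : nat) : W := (\prod_(t < k) s (i + t%:R)%R)%g.
Definition delta (i : 'Z_3) (k : nat) : W := (\prod_(t < k) s (i - t%:R)%R)%g.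

Definition b (n : int) : W :=
  if 0 <= n then gamma 0 `|n|%N else delta 2 `|n|%N.

Definition c (n m : int) : W :=
  if 0 <= m then delta (n + 1)%:~R `|m|%N else gamma (n + 2)%:~R `|m|%N.

Definition a (n m : int) : W := (b n * c n m)%g.

Definition eps (k : int) : int := if odd `|k|%N then 1 else 0.

(** * Geometry *)

Section Geometry.
Variable R : realType.
Implicit Types (x y : 'rV[R]_3).

Definition E : set 'rV[R]_3 := [set x | \sum_i x 0 i = 0].

Definition dot x y : R := \sum_i x 0 i * y 0 i.

Record simple_roots := SimpleRoots {
  alpha : 'rV[R]_3;
  beta : 'rV[R]_3;
  alphaE : E alpha;
  betaE : E beta;
  dot_alpha : dot alpha alpha = 2;
  dot_beta : dot beta beta = 2;
  dot_alpha_beta : dot alpha beta = -1 }.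

(** Orthogonal reflection in the hyperplane of points [x] with
    [dot x g = k]. *)
Definition reflection (g : 'rV[R]_3) (k : int) x : 'rV[R]_3 :=
  x - (2 * (dot x g - k%:~R) / dot g g) *: g.

Definition hull (A : set 'rV[R]_3) : set 'rV[R]_3 :=
  [set x | exists (k : nat) (p : 'I_k -> 'rV[R]_3) (l : 'I_k -> R),
     [/\ forall i, A (p i), forall i, 0 <= l i, \sum_i l i = 1
       & x = \sum_i l i *: p i]].

Lemma dotC x y : dot x y = dot y x.
Proof. by apply: eq_bigr => i _; rewrite mulrC. Qed.

Lemma dotDl x y z : dot (x + y) z = dot x z + dot y z.
Proof. by rewrite -big_split; apply: eq_bigr => i _; rewrite mxE mulrDl. Qed.

Lemma dotZl (k : R) x y : dot (k *: x) y = k * dot x y.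
Proof. by rewrite /dot big_distrr; apply: eq_bigr => i _; rewrite mxE /= mulrA. Qed.

Lemma dotNl x y : dot (- x) y = - dot x y.
Proof. by rewrite -scaleN1r dotZl mulN1r. Qed.

Lemma dotBl x y z : dot (x - y) z = dot x z - dot y z.
Proof. by rewrite dotDl dotNl. Qed.

Lemma dotDr x y z : dot z (x + y) = dot z x + dot z y.
Proof. by rewrite dotC dotDl !(dotC z). Qed.

Lemma dot0l x : dot 0 x = 0.
Proof. by rewrite -(scale0r 0) dotZl mul0r. Qed.

Definition std_simple_roots : simple_roots.
Proof.
pose e (i : 'I_3) : 'rV[R]_3 := delta_mx 0 i.
exists (e 0 - e 1) (e 1 - e (2 : 'Z_3));
  by rewrite /E /dot /= !big_ord_recl !big_ord0 /e !mxE /=; ring.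
Qed.

Variable D : simple_roots.
Local Notation al := (alpha D).
Local Notation be := (beta D).

Definition gen_reflection (i : 'Z_3) : 'rV[R]_3 -> 'rV[R]_3 :=
  if i == 2 then reflection al 0
  else if i == 1 then reflection be 0
  else reflection (al + be) 1.

Definition act_word (u : word) x : 'rV[R]_3 := foldr gen_reflection x u.

Definition act (w : W) x : 'rV[R]_3 := act_word (repr w) x.

Let dot_beta_alpha : dot be al = -1.
Proof. by rewrite dotC dot_alpha_beta. Qed.

Definition dotE := (dotBl, dotDl, dotZl, dotNl, dot0l, dotDr,
  dot_alpha, dot_beta, dot_alpha_beta, dot_beta_alpha).

Lemma dot_highest : dot (al + be) (al + be) = 2.
Proof. by rewrite !dotE; lra. Qed.

(** Each generator translates [x] by a vector of the plane of [al] and [be]. *)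
Lemma gen_reflectionE i x : gen_reflection i x =
  x - (if i == 2 then dot x al else if i == 1 then 0 else dot x al + dot x be - 1)
        *: al
    - (if i == 2 then 0 else if i == 1 then dot x be
       else dot x al + dot x be - 1) *: be.
Proof.
rewrite /gen_reflection /reflection.
case: ifP => _; last case: ifP => _.
- rewrite dot_alpha subr0 scale0r subr0; congr (_ - _ *: _); lra.
- rewrite dot_beta subr0 scale0r subr0; congr (_ - _ *: _); lra.
- rewrite dot_highest dotDr -[RHS]addrA -[in RHS]opprD -scalerDr; congr (_ - _ *: _); lra.
Qed.

Lemma gen_reflection_invol i x : gen_reflection i (gen_reflection i x) = x.
Proof.
rewrite !gen_reflectionE !dotE.
by case: ifP => _; last case: ifP => _;
   apply/rowP => k; rewrite !mxE; ring.
Qed.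

Lemma gen_reflectionD i x (u v : R) :
  gen_reflection i (x - u *: al - v *: be) =
  x - (if i == 2 then dot x al - u + v else if i == 1 then u
       else dot x al + dot x be - v - 1) *: al
    - (if i == 2 then v else if i == 1 then dot x be + u - v
       else dot x al + dot x be - u - 1) *: be.
Proof.
rewrite gen_reflectionE !dotE.
by case: ifP => _; last case: ifP => _;
   apply/rowP => k; rewrite !mxE; ring.
Qed.

Lemma gen_reflection_braid3 i j x : i != j ->
  act_word [:: i; j; i] x = act_word [:: j; i; j] x.
Proof.
rewrite /act_word /= -[x in LHS]subr0 -[x in RHS]subr0.
rewrite -(scale0r al) -[_ - 0 *: al]subr0 -(scale0r be) !gen_reflectionD.
case: i => [[|[|[|//]]] hi]; case: j => [[|[|[|//]]] hj] //= _;
  rewrite /eq_op /=; apply/rowP => k; rewrite !mxE; ring.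
Qed.

Lemma gen_reflection_braid i j x : i != j ->
  act_word [:: i; j; i; j; i; j] x = x.
Proof.
move=> ij; rewrite -[LHS]/(act_word [:: i; j; i] (act_word [:: j; i; j] x)).
by rewrite -(gen_reflection_braid3 x ij) /= !gen_reflection_invol.
Qed.

Lemma act_word_cat u v x : act_word (u ++ v) x = act_word u (act_word v x).
Proof. by rewrite /act_word foldr_cat. Qed.

Lemma act_word_cox u v : cox_rel u v -> act_word u =1 act_word v.
Proof.
elim=> {u v} [|u v _ h|v u w _ h1 _ h2|u u' v v' _ h1 _ h2|i|i j ij] // x.
- by rewrite h1 h2.
- by rewrite !act_word_cat h2 h1.
- exact: gen_reflection_invol.
- exact: gen_reflection_braid.
Qed.

Lemma act_eval u x : act (eval u) x = act_word u x.
Proof. exact/act_word_cox/cox_repr. Qed.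

Lemma act_s i x : act (s i) x = gen_reflection i x.
Proof. by rewrite act_eval. Qed.

Lemma act1 x : act 1%g x = x.
Proof. by rewrite (act_eval [::]). Qed.

Lemma actM v w x : act (v * w)%g x = act v (act w x).
Proof. by rewrite -[v]evalK -[w]evalK -eval_cat !act_eval act_word_cat. Qed.

Definition alcove0 : set 'rV[R]_3 :=
  [set x | [/\ E x, 0 <= dot x al, 0 <= dot x be & dot x (al + be) <= 1]].

Definition alcove (w : W) : set 'rV[R]_3 := act w @` alcove0.

(** The vertices of [alcove0]: see [alcove0_vertices]. *)
Definition vertex (i : 'I_3) : 'rV[R]_3 :=
  [:: 0; 3^-1 *: (2 *: al + be); 3^-1 *: (al + 2 *: be)]`_i.

Definition barycentre (w : W) : 'rV[R]_3 := 3^-1 *: \sum_i act w (vertex i).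

Definition alcove_hull (A : set W) : set W :=
  [set w | hull (barycentre @` A) (barycentre w)].

Lemma dot_suml k (l : 'I_k -> R) (p : 'I_k -> 'rV[R]_3) y :
  dot (\sum_i l i *: p i) y = \sum_i l i * dot (p i) y.
Proof.
elim/big_rec2: _ => [|i z x _ IH]; first exact: dot0l.
by rewrite dotDl dotZl IH.
Qed.

Lemma E_dot x : E x <-> dot x (const_mx 1) = 0.
Proof.
suff -> : dot x (const_mx 1) = \sum_i x 0 i by [].
by apply: eq_bigr => i _; rewrite mxE mulr1.
Qed.

Lemma E_dot_eq0 x : E x -> dot x al = 0 -> dot x be = 0 -> x = 0.
Proof.
move: (alphaE D) (betaE D) (dot_alpha D) (dot_beta D) (dot_alpha_beta D).
rewrite /E /dot /= !big_ord_recl !big_ord0 !addr0.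
set i1 := lift _ _; set i2 := lift _ _.
set a0 := al 0 0; set a1 := al 0 i1; set a2 := al 0 i2.
set b0 := be 0 0; set b1 := be 0 i1; set b2 := be 0 i2.
move=> aE bE aa bb ab xE xa xb.
have a2E : a2 = - a0 - a1 by lra.
have b2E : b2 = - b0 - b1 by lra.
have x2E : x 0 i2 = - x 0 0 - x 0 i1 by lra.
rewrite a2E in aa ab xa; rewrite b2E in bb ab xb; rewrite x2E in xa xb.
pose d := a0 * b1 - a1 * b0.
have dd : 3 * d ^+ 2 = 3.
  transitivity ((a0 * a0 + (a1 * a1 + (- a0 - a1) * (- a0 - a1))) *
    (b0 * b0 + (b1 * b1 + (- b0 - b1) * (- b0 - b1))) -
    (a0 * b0 + (a1 * b1 + (- a0 - a1) * (- b0 - b1))) ^+ 2).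
    by rewrite /d; ring.
  by rewrite aa bb ab; ring.
have d0 : d != 0.
  by apply/eqP => d0; move: dd; rewrite d0 expr0n mulr0 => /eqP; rewrite eq_sym pnatr_eq0.
have x0 : x 0 0 = 0.
  apply: (mulIf d0); apply: (@mulfI _ 3); rewrite ?pnatr_eq0 //.
  transitivity ((b0 + 2 * b1) * (x 0 0 * a0 + (x 0 i1 * a1 +
      (- x 0 0 - x 0 i1) * (- a0 - a1))) - (a0 + 2 * a1) * (x 0 0 * b0 +
      (x 0 i1 * b1 + (- x 0 0 - x 0 i1) * (- b0 - b1)))).
    by rewrite /d; ring.
  by rewrite xa xb; ring.
have x1 : x 0 i1 = 0.
  apply: (mulIf d0); apply: (@mulfI _ 3); rewrite ?pnatr_eq0 //.
  transitivity ((2 * a0 + a1) * (x 0 0 * b0 +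
      (x 0 i1 * b1 + (- x 0 0 - x 0 i1) * (- b0 - b1))) -
      (2 * b0 + b1) * (x 0 0 * a0 + (x 0 i1 * a1 +
      (- x 0 0 - x 0 i1) * (- a0 - a1)))).
    by rewrite /d; ring.
  by rewrite xa xb; ring.
apply/rowP => k; rewrite mxE.
case: (unliftP 0 k) => [j|] ->; last exact: x0.
case: (unliftP 0 j) => [j'|] ->; last exact: x1.
by rewrite (ord1 j') x2E x0 x1; ring.
Qed.

Lemma gen_reflection_affine i k (l : 'I_k -> R) (p : 'I_k -> 'rV[R]_3) :
  \sum_j l j = 1 ->
  gen_reflection i (\sum_j l j *: p j) = \sum_j l j *: gen_reflection i (p j).
Proof.
have aff g h : \sum_j l j = 1 -> reflection g h (\sum_j l j *: p j) =
    \sum_j l j *: reflection g h (p j).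
  move=> l1; rewrite /reflection dot_suml.
  under [RHS]eq_bigr do rewrite scalerBr scalerA.
  rewrite sumrB -scaler_suml; congr (_ - _ *: _).
  under [RHS]eq_bigr do rewrite !mulrA.
  rewrite -mulr_suml; congr (_ / _).
  rewrite [X in 2 * (_ - X)](_ : _ = \sum_j l j * h%:~R); last first.
    by rewrite -mulr_suml l1 mul1r.
  by rewrite -sumrB mulr_sumr; apply: eq_bigr => j _; ring.
by move=> l1; rewrite /gen_reflection; case: ifP => _; last case: ifP => _;
   apply: aff.
Qed.

Lemma act_affine w k (l : 'I_k -> R) (p : 'I_k -> 'rV[R]_3) :
  \sum_j l j = 1 ->
  act w (\sum_j l j *: p j) = \sum_j l j *: act w (p j).
Proof.
move=> l1; rewrite /act; elim: (repr w) => //= i u ->.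
exact: gen_reflection_affine.
Qed.

Lemma alcove0_vertices : alcove0 = hull (range vertex).
Proof.
apply/seteqP; split=> x.
  case=> xE xa xb; rewrite dotDr => xab.
  exists 3%N, vertex, (fun i : 'I_3 => [:: 1 - dot x al - dot x be; dot x al; dot x be]`_i).
  split=> [i|i||]; first by exists i.
  - by case: i => [[|[|[|//]]] hi] //=; lra.
  - by rewrite !big_ord_recl big_ord0 /=; ring.
  rewrite !big_ord_recl big_ord0 /vertex /= scaler0 add0r addr0.
  apply/eqP; rewrite -subr_eq0; apply/eqP/E_dot_eq0.
  + apply/E_dot; move/E_dot: xE => xE.
    have /E_dot aE := alphaE D; have /E_dot bE := betaE D.
    by rewrite !dotE xE aE bE; ring.
  + by rewrite !dotE; field.
  + by rewrite !dotE; field.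
case=> k [p] [l] [pV l0 l1 ->].
have A0E y : dot y (const_mx 1) = 0 -> 0 <= dot y al -> 0 <= dot y be ->
    dot y (al + be) <= 1 -> alcove0 y by move=> /E_dot.
have pA i : alcove0 (p i).
  have [j _ <-] := pV i.
  have /E_dot aE := alphaE D; have /E_dot bE := betaE D.
  by case: j => [[|[|[|//]]] hj]; apply: A0E; rewrite /vertex /= !dotE ?aE ?bE; lra.
apply: A0E; rewrite dot_suml.
- rewrite big1 // => i _; have [/E_dot -> _ _ _] := pA i; exact: mulr0.
- by apply: sumr_ge0 => i _; have [_ ? _ _] := pA i; apply: mulr_ge0.
- by apply: sumr_ge0 => i _; have [_ _ ? _] := pA i; apply: mulr_ge0.
- rewrite -[leRHS]l1; apply: ler_sum => i _; have [_ _ _ ?] := pA i.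
  exact: ler_piMr.
Qed.

(** Each alcove is the triangle whose vertices enter [barycentre]. *)
Lemma alcove_vertices w : alcove w = hull (range (act w \o vertex)).
Proof.
rewrite /alcove alcove0_vertices; apply/seteqP; split=> x.
  case=> _ [k [p [l [pV l0 l1 ->]]]] <-.
  exists k, (act w \o p), l; split=> // [i|]; last exact: act_affine.
  by rewrite /=; have [j _ <-] := pV i; exists j.
case=> k [p] [l] [pV l0 l1 ->].
have /choice [j jE] : forall i, exists j, act w (vertex j) = p i.
  by move=> i; have [j _ <-] := pV i; exists j.
exists (\sum_i l i *: vertex (j i)).
  by exists k, (vertex \o j), l; split=> // i; exists (j i).
by rewrite act_affine //; apply: eq_bigr => i _; rewrite jE.
Qed.

End Geometry.

(* Main.v *)
(** Record each alcove by the integer parts [p], [q] of the coordinates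
    [<x, alpha>], [<x, beta>] and by its orientation.  Right multiplication by a
    generator crosses one wall of the alcove, and the number of hyperplanes
    separating an alcove from the identity alcove changes by one; when both
    [s i] and [s j] decrease it, so does every letter of [s i * s j * s i].
    Hence (exchange, Matsumoto) any two words of minimal length for the same
    element are related by braid moves, which do not change the set of end
    alcoves of folded galleries.  The shadow can therefore be computed along
    the single word [gamma 0 n ++ delta (n + 1) m], where each new letter [s i]
    replaces a set [H] by [H] united with [H * s i].

    In the coordinates [X = <x, 2 alpha + beta>], [Y = <x, alpha + 2 beta>] of
    barycentres, which are integers, all the sets obtained in this way are
    hexagons [x0 <= X <= x1], [y0 <= Y <= y1], [z0 <= X - Y <= z1], and the six
    given alcoves are the corners of the hexagon of [(n, m)]. *)

Require Import Defs.
From mathcomp Require Import all_boot all_order all_algebra.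
From mathcomp Require Import classical_sets reals.
From mathcomp Require Import zify.
From mathcomp Require Import ring lra.

Set Implicit Arguments.
Unset Strict Implicit.
Unset Printing Implicit Defensive.

Import Order.TTheory GRing.Theory Num.Theory.
Local Open Scope classical_set_scope.
Local Open Scope ring_scope.

(** * Alcoves in integer coordinates, with left and right multiplication *)

(** The open triangle [p < <x, alpha> < p + 1], [q < <x, beta> < q + 1],
    [p + q + o < <x, alpha + beta> < p + q + o + 1], where [o] is [down] read
    as [0] or [1]. *)
Record alc := Alc { fp : int; fq : int; down : bool }.

(** The vertex [(p, q)] of the weight lattice has type [q - p] modulo 3; hence
    right multiplication by the generator [z] crosses the wall orthogonal to
    [alpha + beta] if this is [0], and if it is [1] (resp. [2]) the wall
    orthogonal to [beta] (resp. [alpha]) when the alcove points up, with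
    [alpha] and [beta] exchanged when it points down. *)
Definition wall (x : alc) (z : int) : int := ((z + fp x - fq x) %% 3)%Z.

Definition cross (x : alc) (r : int) : alc :=
  let: Alc p q o := x in
  if r == 0 then Alc p q (~~ o)
  else if r == 1 then (if o then Alc (p + 1) q false else Alc p (q - 1) true)
  else (if o then Alc p (q + 1) false else Alc (p - 1) q true).

(** [z] is any integer, so subscripts such as [n + 1 - m] are reduced modulo 3 only inside [wall],
    within reach of [lia]. *)
Definition stepz (x : alc) (z : int) : alc := cross x (wall x z).

Definition step x (i : 'Z_3) := stepz x (i : nat)%:Z.

(** Left multiplication by [s i]. *)
Definition refl (i : 'Z_3) (x : alc) : alc :=
  let: Alc p q o := x in
  if i == 2 then Alc (- p - 1) (p + q + o) (~~ o)
  else if i == 1 then Alc (p + q + o) (- q - 1) (~~ o)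
  else Alc (- q) (- p) (~~ o).

Lemma Z3_cases (P : 'Z_3 -> Prop) : P 0 -> P 1 -> P 2 -> forall i, P i.
Proof.
move=> h0 h1 h2 [[|[|[|//]]] hi].
- by rewrite (_ : Ordinal hi = 0) //; apply: val_inj.
- by rewrite (_ : Ordinal hi = 1) //; apply: val_inj.
- by rewrite (_ : Ordinal hi = 2) //; apply: val_inj.
Qed.

Ltac alc_cases := repeat (case: ifP => /eqP ? /=); try (f_equal; lia); lia.

(** Reflections preserve the types of vertices, hence the generator attached to each wall. *)
Lemma refl_step j x i : refl j (step x i) = step (refl j x) i.
Proof.
case: x => p q o; rewrite /step; move: (i : nat)%:Z => z.
elim/Z3_cases: j; rewrite /refl /= /stepz /wall; case: o => /=; alc_cases.
Qed.

Lemma reflK i x : refl i (refl i x) = x.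
Proof.
case: x => p q o; elim/Z3_cases: i; case: o; rewrite /refl /=; f_equal; lia.
Qed.

Lemma refl_braid i j x : i != j ->
  refl i (refl j (refl i (refl j (refl i (refl j x))))) = x.
Proof.
case: x => p q o; elim/Z3_cases: i; elim/Z3_cases: j => //= _;
case: o => /=; f_equal; lia.
Qed.

Lemma stepK i x : step (step x i) i = x.
Proof.
case: x => p q o; rewrite /step; move: (i : nat)%:Z => z.
rewrite /stepz /wall; case: o => /=; alc_cases.
Qed.

Definition alc0 := Alc 0 0 false.

Definition refls (u : word) (x : alc) : alc := foldr refl x u.

Lemma refls_cat u v x : refls (u ++ v) x = refls u (refls v x).
Proof. by rewrite /refls foldr_cat. Qed.

Lemma refls_cox u v : cox_rel u v -> refls u =1 refls v.
Proof.
elim=> {u v} [|u v _ h|v u w _ h1 _ h2|u u' v v' _ h1 _ h2|i|i j ij] // x.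
- by rewrite h1 h2.
- by rewrite !refls_cat h2 h1.
- exact: reflK.
- exact: refl_braid.
Qed.

(** Built from left multiplication, where invariance under the Coxeter relations is checked relator
    by relator; [pos_mul_s] recovers right multiplication. *)
Definition pos (w : W) : alc := refls (repr w) alc0.

Lemma pos_eval u : pos (eval u) = refls u alc0.
Proof. exact/refls_cox/cox_repr. Qed.

Lemma refl_alc0 i : refl i alc0 = step alc0 i.
Proof. by elim/Z3_cases: i. Qed.

Lemma refls_step u x i : refls u (step x i) = step (refls u x) i.
Proof. by elim: u => //= j u ->; rewrite refl_step. Qed.

Lemma eval_rcons u i : eval (rcons u i) = (eval u * s i)%g.
Proof. by rewrite -cats1 eval_cat. Qed.

Lemma pos1 : pos 1%g = alc0. Proof. exact: (pos_eval [::]). Qed.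

Lemma pos_mul_s w i : pos (w * s i)%g = step (pos w) i.
Proof.
rewrite -[w]evalK -eval_cat !pos_eval refls_cat -refls_step.
by rewrite -refl_alc0.
Qed.

(** * Length as a count of hyperplanes *)

(** The number of hyperplanes separating [x] from [alc0]. *)
Definition len (x : alc) : nat :=
  let: Alc p q o := x in (`|p| + `|q| + `|(p + q + o)%R|)%N.

(** Crossing a wall moves exactly one of [p], [q], [p + q + o] by one. *)
Lemma len_step x i :
  len (step x i) = (len x).+1 \/ len x = (len (step x i)).+1.
Proof.
case: x => p q o; rewrite /step; move: (i : nat)%:Z => z.
rewrite /stepz /wall; case: o => /=; repeat (case: ifP => /eqP ?); rewrite /len; lia.
Qed.

Lemma wall_range x z : 0 <= wall x z < 3.
Proof. by rewrite /wall; lia. Qed.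

Lemma wall_cross x r z : 0 <= r < 3 ->
  wall (cross x r) z = ((wall x z + r) %% 3)%Z.
Proof.
case: x => p q o; rewrite /wall; case: o => /= ?;
repeat (case: ifP => /eqP ? /=); lia.
Qed.

(** [x] is the farthest from [alc0] of the six alcoves around a vertex; the three steps lead to the
    opposite one, across all three lines through that vertex. *)
Lemma len_dihedral x i j : i != j ->
  (len (step x i) < len x)%N -> (len (step x j) < len x)%N ->
  (len (step (step (step x i) j) i)).+3 = len x.
Proof.
move=> /eqP ij; rewrite /step /stepz.
rewrite !(wall_cross, wall_range, modz_ge0, ltz_pmod) //.
have : wall x i%:Z <> wall x j%:Z.
  move=> e; apply: ij; apply: val_inj => /=; move: e; rewrite /wall.
  by have : (j < 3)%N := ltn_ord j; have : (i < 3)%N := ltn_ord i; lia.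
have := wall_range x i%:Z; have := wall_range x j%:Z.
move: (wall x _) (wall x _) => r' r; case: x => p q o.
case: r => [[|[|[|r]]]|] //; case: r' => [[|[|[|r']]]|] // _ _ _;
case: o => /=; lia.
Qed.

(** * Folded galleries and braid moves *)

Lemma s_invol i : (s i * s i = 1)%g.
Proof. by rewrite /s -eval_cat; apply/evalP/cox_invol. Qed.

Lemma mulg_sK w i : (w * s i * s i)%g = w.
Proof. by rewrite -mulgA s_invol mulg1. Qed.

Lemma s_braid i j : i != j -> (s i * s j * s i = s j * s i * s j)%g.
Proof.
move=> ij; set y := (s j * s i * s j)%g.
have yy : (y * y = 1)%g by rewrite /y !mulgA mulg_sK mulg_sK s_invol.
rewrite -[LHS]mulg1 -yy mulgA -[RHS]mul1g; congr (_ * _)%g.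
have /evalP := cox_braid ij.
by rewrite !eval_prod !big_cons big_nil !mulg1 /y !mulgA.
Qed.

Lemma gallery_nil v : gallery_end [::] v <-> v = 1%g.
Proof.
split=> [[c [c0 _ <-]] //|->]; by exists (fun=> 1%g).
Qed.

(** The last step is a fold or a crossing; a crossing that ends at [v] starts at [v * s i], as [s i]
    is an involution. *)
Lemma gallery_rcons u i v :
  gallery_end (rcons u i) v <-> gallery_end u v \/ gallery_end u (v * s i)%g.
Proof.
split.
  case=> c []; rewrite size_rcons => c0 cs cv.
  have cu t : (t < size u)%N -> c t.+1 = c t \/ c t.+1 = (c t * s (nth 0 u t))%g.
    by move=> tu; have := cs t (ltnW tu); rewrite nth_rcons tu.
  have := cs _ (ltnSn _); rewrite nth_rcons ltnn eqxx cv.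
  by case=> ->; [left|right; rewrite mulg_sK]; exists c.
have ext x : gallery_end u x -> (v = x \/ v = x * s i)%g ->
    gallery_end (rcons u i) v.
  case=> c [c0 cs cv] vx.
  exists (fun t => if (t <= size u)%N then c t else v); rewrite size_rcons ltnn.
  split=> // t; rewrite ltnS => tu; rewrite tu nth_rcons.
  case: ltnP => [|ut]; first exact: cs.
  have -> : t = size u by apply/eqP; rewrite eqn_leq tu.
  by rewrite eqxx cv.
by case=> h; apply: ext h _; [left|right; rewrite mulg_sK].
Qed.

(** Records what braid moves preserve. *)
Definition braid_eq (u v : word) : Prop :=
  eval u = eval v /\ forall x, gallery_end u x <-> gallery_end v x.

Lemma braid_eq_trans u v w : braid_eq u v -> braid_eq v w -> braid_eq u w.
Proof.
case=> e1 g1 [e2 g2]; split; first by rewrite e1.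
by move=> x; rewrite g1 g2.
Qed.

Lemma braid_eq_rcons u v i : braid_eq u v -> braid_eq (rcons u i) (rcons v i).
Proof.
case=> e g; split; first by rewrite !eval_rcons e.
by move=> x; rewrite !gallery_rcons !g.
Qed.

(** The eight fold patterns of either word produce the same six products of [s i] and [s j]. *)
Lemma braid_eq_braid u i j : i != j ->
  braid_eq (rcons (rcons (rcons u i) j) i) (rcons (rcons (rcons u j) i) j).
Proof.
move=> ij; split.
  by rewrite !eval_rcons -!mulgA !(mulgA (s _)) s_braid.
move=> x; rewrite !gallery_rcons !mulg_sK.
rewrite -(mulgA x) -!(mulgA (x * _)%g) -!(mulgA x) !(mulgA (s _)) (s_braid ij).
tauto.
Qed.

(** * Reduced words: exchange and Matsumoto's theorem *)

Definition length_reduced (u : word) := size u = len (pos (eval u)).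

Lemma len_size u : (len (pos (eval u)) <= size u)%N.
Proof.
elim/last_ind: u => [|u i IH]; first by rewrite pos1.
rewrite eval_rcons pos_mul_s size_rcons.
by case: (len_step (pos (eval u)) i); lia.
Qed.

Lemma length_reduced_rcons u i :
  length_reduced (rcons u i) <->
  length_reduced u /\ len (step (pos (eval u)) i) = (size u).+1.
Proof.
rewrite /length_reduced eval_rcons pos_mul_s size_rcons.
have := len_size u; case: (len_step (pos (eval u)) i); lia.
Qed.

Lemma length_reduced_desc u i : length_reduced (rcons u i) ->
  (len (step (pos (eval (rcons u i))) i) < len (pos (eval (rcons u i))))%N.
Proof.
move=> h; rewrite -h eval_rcons pos_mul_s stepK size_rcons.
by have := len_size u; lia.
Qed.

Lemma braid_eq_reduced u v : braid_eq u v -> size u = size v ->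
  length_reduced u -> length_reduced v.
Proof. by case=> e _; rewrite /length_reduced e => ->. Qed.

Lemma exchange v i : length_reduced v ->
  (len (step (pos (eval v)) i) < len (pos (eval v)))%N ->
  exists2 u, braid_eq v (rcons u i) & size v = (size u).+1.
Proof.
have [k] := ubnP (size v); elim: k v i => // k IH v i.
case/lastP: v => [|v j] vk vr di; first by move: di; rewrite -vr.
have [<-|ij] := eqVneq j i.
  by exists v => //; rewrite size_rcons.
have dj := length_reduced_desc vr; have [vr' _] := (length_reduced_rcons _ _).1 vr.
have dh := len_dihedral ij dj di.
have dv : step (pos (eval (rcons v j))) j = pos (eval v).
  by rewrite eval_rcons pos_mul_s stepK.
rewrite size_rcons in vk *; rewrite dv in dh.
have lv : (len (pos (eval (rcons v j)))) = (size v).+1.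
  by rewrite -vr size_rcons.
(* A drop of three in three steps forces each step to decrease the length. *)
have h1 : (len (step (pos (eval v)) i) < len (pos (eval v)))%N.
  by case: (len_step (step (pos (eval v)) i) j); move: vr';
     rewrite /length_reduced; lia.
have [|v2 vv2 sv2] := IH v i _ vr' h1; first by lia.
have vr2 := braid_eq_reduced vv2 (etrans sv2 (esym (size_rcons _ _))) vr'.
have pv2 : step (pos (eval v)) i = pos (eval v2).
  by rewrite vv2.1 eval_rcons pos_mul_s stepK.
have [vr2' _] := (length_reduced_rcons _ _).1 vr2.
have [||v3 vv3 sv3] := IH v2 j _ vr2'; first by lia.
  by rewrite -pv2; move: vr2'; rewrite /length_reduced -pv2; lia.
(* The word has become [v3] followed by [j i j], which a braid move turns into [i j i]. *)
exists (rcons (rcons v3 i) j); last by rewrite !size_rcons; lia.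
apply: braid_eq_trans (braid_eq_braid v3 ij).
apply: braid_eq_rcons; apply: (braid_eq_trans vv2); exact: braid_eq_rcons.
Qed.

(** [exchange] gives [u] the last letter of [v], which is then removed from both. Only positions are
    assumed equal, so that [pos_inj] follows. *)
Lemma matsumoto u v : length_reduced u -> length_reduced v ->
  pos (eval u) = pos (eval v) -> braid_eq u v.
Proof.
have [k] := ubnP (size v); elim: k u v => // k IH u v.
case/lastP: v => [|v j] vk ur vr uv.
  by move: (ur); rewrite /length_reduced uv -vr; case: (u).
have dj := length_reduced_desc vr; have [vr' _] := (length_reduced_rcons _ _).1 vr.
rewrite -uv in dj; have [u' uu' su'] := exchange ur dj.
have ur' := braid_eq_reduced uu' (etrans su' (esym (size_rcons _ _))) ur.
have [ur'' _] := (length_reduced_rcons _ _).1 ur'.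
apply: (braid_eq_trans uu'); apply: braid_eq_rcons; apply: IH => //.
  by rewrite size_rcons in vk; lia.
move: uv; rewrite uu'.1 !eval_rcons !pos_mul_s => /(congr1 (step^~ j)).
by rewrite /= !stepK.
Qed.

Lemma exists_length_reduced u : exists2 v, eval v = eval u & length_reduced v.
Proof.
elim/last_ind: u => [|u i [v vu vr]].
  by exists [::] => //; rewrite /length_reduced pos1.
rewrite eval_rcons -vu.
case: (len_step (pos (eval v)) i) => h.
  exists (rcons v i); first by rewrite eval_rcons.
  by apply/length_reduced_rcons; split=> //; rewrite h vr.
have [|v' vv' sv'] := exchange vr (i := i); first by rewrite h.
have vr' := braid_eq_reduced vv' (etrans sv' (esym (size_rcons _ _))) vr.
exists v'; last by have [] := (length_reduced_rcons _ _).1 vr'.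
by rewrite vv'.1 eval_rcons mulg_sK.
Qed.

Lemma pos_inj : injective pos.
Proof.
move=> x y; rewrite -[x]evalK -[y]evalK.
have [u <- ur] := exists_length_reduced (repr x).
have [v <- vr] := exists_length_reduced (repr y).
by move=> /(matsumoto ur vr) [].
Qed.

Lemma length_reducedP u : length_reduced u <-> reduced u.
Proof.
split=> [ur v vu|ur]; first by rewrite ur -vu len_size.
have [v vu vr] := exists_length_reduced u.
apply/eqP; rewrite eqn_leq len_size -vu -vr ur //.
Qed.

Lemma Sh_length_reduced u v : length_reduced u -> Sh (eval u) v <-> gallery_end u v.
Proof.
move=> ur; split=> [[u' [/length_reducedP ur' e]]|g]; last first.
  by exists u; split=> //; apply/length_reducedP.
by have [_ ->] := matsumoto ur' ur (congr1 pos e).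
Qed.

(** * Integer coordinates of the alcove [a n m] *)

Lemma Z3_intr (z : int) : ((z%:~R : 'Z_3) : nat)%:Z = (z %% 3)%Z.
Proof.
have -> : (z%:~R : 'Z_3) = `|(z %% 3)%Z|%N%:R.
  rewrite {1}(divz_eq z 3) intrD intrM.
  have -> : (3%:~R : 'Z_3) = 0 by apply: val_inj.
  rewrite mulr0 add0r -{1}[(z %% 3)%Z]gez0_abs ?pmulrn //; exact: modz_ge0.
rewrite val_Zp_nat // modn_small; lia.
Qed.

Lemma step_intr x (z : int) : step x z%:~R = stepz x z.
Proof.
rewrite /step /stepz Z3_intr; congr cross; rewrite /wall; lia.
Qed.

Lemma pos_gammaS w (z : int) k :
  pos (w * gamma z%:~R k.+1)%g = stepz (pos (w * gamma z%:~R k)%g) (z + k%:Z).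
Proof.
by rewrite /gamma big_ord_recr /= mulgA pos_mul_s pmulrn -intrD step_intr.
Qed.

Lemma pos_deltaS w (z : int) k :
  pos (w * delta z%:~R k.+1)%g = stepz (pos (w * delta z%:~R k)%g) (z - k%:Z).
Proof.
by rewrite /delta big_ord_recr /= mulgA pos_mul_s pmulrn -intrB step_intr.
Qed.

Lemma gamma0 i : gamma i 0 = 1%g. Proof. exact: big_ord0. Qed.
Lemma delta0 i : delta i 0 = 1%g. Proof. exact: big_ord0. Qed.

(** The barycentre of the alcove is [X / 3 *: alpha + Y / 3 *: beta]. *)
Definition xcoord (x : alc) : int := let: Alc p q o := x in 2 * p + q + 1 + o.
Definition ycoord (x : alc) : int := let: Alc p q o := x in p + 2 * q + 1 + o.

Ltac stepz_lia x := rewrite /stepz /wall; case: x => ? ? [] /=;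
  repeat (case: ifP => /eqP ? /=); lia.

(** [X] and [Y] determine the alcove, since [X + Y] modulo 3 gives its orientation; tracking them
    suffices for the induction. *)
Lemma pos_b n : xcoord (pos (b n)) = n + 1 /\
  ycoord (pos (b n)) = ((n + 1) %/ 2)%Z + 1.
Proof.
rewrite /b; case: n => N /=.
  rewrite -[gamma 0 N]mul1g -[0 : 'Z_3]/(0%:~R).
  elim: N => [|N IH]; first by rewrite gamma0 mul1g pos1.
  rewrite pos_gammaS; move: IH; set x := pos _; stepz_lia x.
rewrite -[delta 2 _]mul1g -[2 : 'Z_3]/(2%:~R).
elim: N => [|N IH].
  (* [Negz N] is [- (N + 1)], so the base case already has one letter. *)
  rewrite pos_deltaS delta0 mul1g pos1 /=; lia.
rewrite pos_deltaS; move: IH; set x := pos _; stepz_lia x.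
Qed.

Lemma pos_a n m : xcoord (pos (a n m)) = n + 1 + (m %/ 2)%Z /\
  ycoord (pos (a n m)) = ((n + 1) %/ 2)%Z + 1 +
    (if (n %% 2)%Z == 0 then - ((m + 1) %/ 2)%Z else m).
Proof.
have [hx hy] := pos_b n.
rewrite /a /c; case: m => M /=.
  elim: M => [|M IH]; first by rewrite delta0 mulg1; case: ifP => /eqP ?; lia.
  rewrite pos_deltaS; move: IH; set x := pos _; stepz_lia x.
elim: M => [|M IH].
  rewrite pos_gammaS gamma0 mulg1; move: hx hy; set x := pos _; stepz_lia x.
rewrite pos_gammaS; move: IH; set x := pos _; stepz_lia x.
Qed.

(** * Growth of the shadow through hexagons *)

Definition hexagon (x0 x1 y0 y1 z0 z1 X Y : int) :=
  [&& x0 <= X <= x1, y0 <= Y <= y1 & z0 <= X - Y <= z1].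

(** The shadow of [a n 0]; [hexagon_a n 0] differs from it. *)
Definition hexagon_b (n : int) (X Y : int) :=
  let k := (n %/ 2)%Z in let e := (n %% 2)%Z in
  hexagon (2 - k - e) (n + 1) (2 - n) (k + 1 + e) (2 - n) k X Y.

Definition hexagon_a (n m : int) (X Y : int) :=
  let k := (n %/ 2)%Z in let e := (n %% 2)%Z in let l := (m %/ 2)%Z in
  hexagon (3 - k - m - 2 * e) (n + 1 + l) (2 - n - l) (k + m + 2 * e)
    (2 - n - l) (k + m - e) X Y.

Lemma hexagon_b_step (n : int) x : 2 <= n ->
  hexagon_b (n + 1) (xcoord x) (ycoord x) <->
  hexagon_b n (xcoord x) (ycoord x) \/
  hexagon_b n (xcoord (stepz x n)) (ycoord (stepz x n)).
Proof.
move=> n2; rewrite /hexagon_b /hexagon /stepz /wall.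
case: x => p q o; case: o => /=; repeat (case: ifP => /eqP ? /=); lia.
Qed.

Lemma hexagon_a1_step (n : int) x : 2 <= n ->
  hexagon_a n 1 (xcoord x) (ycoord x) <->
  hexagon_b n (xcoord x) (ycoord x) \/
  hexagon_b n (xcoord (stepz x (n + 1))) (ycoord (stepz x (n + 1))).
Proof.
move=> n2; rewrite /hexagon_a /hexagon_b /hexagon /stepz /wall.
case: x => p q o; case: o => /=; repeat (case: ifP => /eqP ? /=); lia.
Qed.

Lemma hexagon_a_step (n m : int) x : 2 <= n -> 1 <= m ->
  hexagon_a n (m + 1) (xcoord x) (ycoord x) <->
  hexagon_a n m (xcoord x) (ycoord x) \/
  hexagon_a n m (xcoord (stepz x (n + 1 - m))) (ycoord (stepz x (n + 1 - m))).
Proof.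
move=> n2 m1; rewrite /hexagon_a /hexagon /stepz /wall.
case: x => p q o; case: o => /=; repeat (case: ifP => /eqP ? /=); lia.
Qed.

(** Shows that the defining word of [a n m], with [n + m] letters, is reduced. *)
Lemma len_a (n m : int) : 0 <= n -> 0 <= m -> len (pos (a n m)) = `|(n + m)%R|%N.
Proof.
move=> n0 m0; have [] := pos_a n m; case: (pos _) => p q [] /=;
by case: ifP => /eqP ?; lia.
Qed.

(** Concerns one word, reduced or not; reducedness enters only in [Sh_hexagon]. *)
Definition gallery_hex (w : W) (k : nat) (H : int -> int -> bool) : Prop :=
  exists u, [/\ eval u = w, size u = k &
    forall v, gallery_end u v <-> H (xcoord (pos v)) (ycoord (pos v))].

Lemma gallery_hex_step w k (H H' : int -> int -> bool) (i : int) :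
  (forall x, H' (xcoord x) (ycoord x) <->
     H (xcoord x) (ycoord x) \/ H (xcoord (stepz x i)) (ycoord (stepz x i))) ->
  gallery_hex w k H -> gallery_hex (w * s i%:~R)%g k.+1 H'.
Proof.
move=> HH' [u [uw uk uH]]; exists (rcons u i%:~R); split=> [||v].
- by rewrite eval_rcons uw.
- by rewrite size_rcons uk.
- by rewrite gallery_rcons HH' !uH pos_mul_s step_intr.
Qed.

Lemma aS (n : int) (k : nat) : a n k.+1 = (a n k * s (n + 1 - k%:Z)%:~R)%g.
Proof.
by rewrite /a /c /= /delta big_ord_recr /= mulgA intrB pmulrn.
Qed.

Lemma a0 (n : int) : a n 0 = b n.
Proof. by rewrite /a /c /= delta0 mulg1. Qed.

Lemma bS (n : nat) : b n.+1 = (b n * s (n%:Z)%:~R)%g.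
Proof. by rewrite /b /= /gamma big_ord_recr /= add0r pmulrn. Qed.

(** The induction starts at two letters, since [hexagon_b 0] and [hexagon_b 1] are empty, unlike the
    shadows. *)
Lemma gallery_b (n : nat) : gallery_hex (b n.+2) n.+2 (hexagon_b n.+2).
Proof.
elim: n => [|n IH]; last first.
  have := gallery_hex_step (fun x => hexagon_b_step x (isT : 2 <= n.+2%:Z)) IH.
  by rewrite -bS addrC -intS.
exists [:: 0; 1]; split=> [|//|v].
  rewrite /b /= /gamma eval_prod big_cons big_seq1 !big_ord_recl big_ord0 mulg1.
  by congr (s _ * s _)%g; apply: val_inj.
rewrite -[[:: 0; 1]]/(rcons (rcons [::] 0%:~R) 1%:~R) !gallery_rcons !gallery_nil.
have e w : w = 1%g <-> pos w = alc0.
  by split=> [->|]; [exact: pos1 | rewrite -pos1 => /pos_inj].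
rewrite !e !pos_mul_s !step_intr /hexagon_b /hexagon /alc0 /stepz /wall.
case: (pos v) => p q o.
have E p' q' o' p1 q1 o1 :
    Alc p' q' o' = Alc p1 q1 o1 <-> [&& p' == p1, q' == q1 & o' == o1].
  by split=> [[-> -> ->]|/and3P [/eqP -> /eqP -> /eqP ->] //]; rewrite !eqxx.
case: o => /=; repeat (case: ifP => /eqP ? /=); rewrite !E; lia.
Qed.

Lemma gallery_a (n m : nat) :
  gallery_hex (a n.+2 m.+1) (n.+2 + m.+1)%N (hexagon_a n.+2 m.+1).
Proof.
elim: m => [|m IH].
  rewrite aS subr0 a0 addn1.
  apply: gallery_hex_step (gallery_b n) => x; exact: hexagon_a1_step.
have := gallery_hex_step (fun x =>
  hexagon_a_step x (isT : 2 <= n.+2%:Z) (isT : 1 <= m.+1%:Z)) IH.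
by rewrite -aS addrC -intS -addnS.
Qed.

Lemma Sh_hexagon (n m : int) v : 2 <= n -> 1 <= m ->
  Sh (a n m) v <-> hexagon_a n m (xcoord (pos v)) (ycoord (pos v)).
Proof.
case: n => [[|[|n]]|] //; case: m => [[|m]|] // _ _.
have [u [ua us uH]] := gallery_a n m.
rewrite -uH -ua; apply: Sh_length_reduced.
by rewrite /length_reduced ua us len_a.
Qed.

(** * Convex hulls in the plane *)

Section Hull.
Variable R : realType.
Implicit Types (A : set 'rV[R]_3) (x y : 'rV[R]_3).

Lemma hull_sub A x : A x -> hull A x.
Proof.
move=> Ax; exists 1%N, (fun=> x), (fun=> 1).
by split=> //; rewrite big_ord1 ?scale1r.
Qed.

Lemma hull_conv A x y (t : R) : 0 <= t <= 1 -> hull A x -> hull A y ->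
  hull A ((1 - t) *: x + t *: y).
Proof.
move=> /andP [t0 t1] [k [p [l [pA l0 l1 ->]]]] [k' [p' [l' [pA' l0' l1' ->]]]].
exists (k + k')%N.
exists (fun i => match split i with inl j => p j | inr j => p' j end).
exists (fun i => match split i with inl j => (1 - t) * l j | inr j => t * l' j end).
split=> [i|i||].
- by case: split => j.
- by case: split => j; rewrite mulr_ge0 // subr_ge0.
- rewrite big_split_ord /=.
  under eq_bigr do rewrite (unsplitK (inl _)).
  under [X in _ + X]eq_bigr do rewrite (unsplitK (inr _)).
  by rewrite -!mulr_sumr l1 l1' !mulr1 subrK.
- rewrite big_split_ord /=.
  under [X in _ = X + _]eq_bigr do rewrite (unsplitK (inl _)) -scalerA.
  under [X in _ = _ + X]eq_bigr do rewrite (unsplitK (inr _)) -scalerA.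
  by rewrite -!scaler_sumr.
Qed.

Lemma hull_dot_ge A g (c : R) : (forall x, A x -> c <= dot x g) ->
  forall x, hull A x -> c <= dot x g.
Proof.
move=> Ac x [k [p [l [pA l0 l1 ->]]]]; rewrite dot_suml.
rewrite -[c]mul1r -l1 mulr_suml; apply: ler_sum => i _.
by rewrite ler_wpM2l // Ac.
Qed.

Variable D : simple_roots R.
Local Notation al := (alpha D).
Local Notation be := (beta D).

Definition point (X Y : R) : 'rV[R]_3 := (X / 3) *: al + (Y / 3) *: be.

Lemma hull_seg A (X Y dx dy s1 s2 r : R) : s1 <= r <= s2 ->
  hull A (point (X + s1 * dx) (Y + s1 * dy)) ->
  hull A (point (X + s2 * dx) (Y + s2 * dy)) ->
  hull A (point (X + r * dx) (Y + r * dy)).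
Proof.
move=> /andP [r1 r2] h1 h2.
have [e|ne] := eqVneq s1 s2.
  by have -> : r = s1 by apply/eqP; rewrite eq_le r1 e r2.
have lt : 0 < s2 - s1 by rewrite subr_gt0 lt_neqAle ne (le_trans r1).
pose t := (r - s1) / (s2 - s1).
have -> : point (X + r * dx) (Y + r * dy) =
    (1 - t) *: point (X + s1 * dx) (Y + s1 * dy) +
    t *: point (X + s2 * dx) (Y + s2 * dy).
  have tE : t * (s2 - s1) = r - s1 by rewrite /t divfK // gt_eqF.
  have -> : r = s1 + t * (s2 - s1) by rewrite tE; ring.
  by rewrite /point; apply/rowP => k; rewrite !mxE; ring.
apply: hull_conv => //; apply/andP; split.
  by rewrite divr_ge0 ?subr_ge0 // ltW // -subr_gt0.
by rewrite ler_pdivrMr // mul1r lerB.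
Qed.

Lemma hull_hexagon A (x0 x1 y0 y1 z0 z1 X Y : R) :
  hull A (point x1 y1) -> hull A (point (z0 + y1) y1) -> hull A (point x0 (x0 - z0)) ->
  hull A (point x0 y0) -> hull A (point (z1 + y0) y0) -> hull A (point x1 (x1 - z1)) ->
  x0 <= X <= x1 -> y0 <= Y <= y1 -> z0 <= X - Y <= z1 -> hull A (point X Y).
Proof.
move=> h1 h2 h3 h4 h5 h6 /andP [X0 X1] /andP [Y0 Y1] /andP [Z0 Z1].
have horiz X1' X2' X' Y' : X1' <= X' <= X2' ->
    hull A (point X1' Y') -> hull A (point X2' Y') -> hull A (point X' Y').
  have := @hull_seg A 0 Y' 1 0 X1' X2' X'.
  by rewrite !mulr0 !mulr1 !add0r !addr0.
have vert X' Y1' Y2' Y' : Y1' <= Y' <= Y2' ->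
    hull A (point X' Y1') -> hull A (point X' Y2') -> hull A (point X' Y').
  have := @hull_seg A X' 0 0 1 Y1' Y2' Y'.
  by rewrite !mulr0 !mulr1 !add0r !addr0.
have diag z X1' X2' X' : X1' <= X' <= X2' ->
    hull A (point X1' (X1' - z)) -> hull A (point X2' (X2' - z)) ->
    hull A (point X' (X' - z)).
  have := @hull_seg A 0 (- z) 1 1 X1' X2' X'.
  by rewrite !mulr1 !add0r ![- z + _]addrC.
(* The vertical line through [(X, Y)] meets the boundary of the hexagon above
   and below that point, each time on a segment between two corners. *)
have up : exists2 Y', Y <= Y' & hull A (point X Y').
  have [le|/ltW ge] := leP X (z0 + y1).
    exists (X - z0); first by lra.
    apply: (diag _ x0 (z0 + y1)) => //; first by rewrite X0.
    by have -> : z0 + y1 - z0 = y1 by ring.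
  by exists y1 => //; apply: (horiz (z0 + y1) x1) => //; rewrite ge.
have dn : exists2 Y', Y' <= Y & hull A (point X Y').
  have [le|/ltW ge] := leP X (z1 + y0).
    by exists y0 => //; apply: (horiz x0 (z1 + y0)) => //; rewrite X0.
  exists (X - z1); first by lra.
  apply: (diag _ (z1 + y0) x1) => //; first by rewrite ge.
  by have -> : z1 + y0 - z1 = y0 by ring.
have [Y2 YY2 H2] := up; have [Y3 YY3 H3] := dn.
by apply: vert H3 H2; rewrite YY3.
Qed.

Lemma gen_reflection_point i (x : alc) :
  gen_reflection D i (point (xcoord x)%:~R (ycoord x)%:~R) =
  point (xcoord (refl i x))%:~R (ycoord (refl i x))%:~R.
Proof.
rewrite gen_reflectionE /point !dotE.
case: x => p q o; elim/Z3_cases: i; case: o;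
rewrite /= ?rmorphD ?rmorphM ?rmorphB ?rmorphN ?rmorph1 ?rmorph0 /=;
by apply/rowP => k; rewrite !mxE; field.
Qed.

(** Affine maps preserve barycentres, and [point 1 1] is that of the identity alcove. *)
Lemma barycentre_point w :
  barycentre D w = point (xcoord (pos w))%:~R (ycoord (pos w))%:~R.
Proof.
have -> : barycentre D w = act D w (point 1 1).
  have -> : point 1 1 = \sum_(i < 3) 3^-1 *: vertex D i.
    rewrite !big_ord_recl big_ord0 /vertex /point /=.
    by apply/rowP => k; rewrite !mxE; field.
  have l1 : \sum_(i < 3) (3^-1 : R) = 1.
    by rewrite !big_ord_recl big_ord0; field.
  by rewrite act_affine // /barycentre scaler_sumr.
rewrite /act /pos; elim: (repr w) => //= i u ->.
exact: gen_reflection_point.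
Qed.

(** [2 *: al + be] and [al + 2 *: be] are three times the fundamental weights, which are dual to
    [al] and [be]. *)
Lemma point_dot (X Y c d : R) :
  dot (point X Y) ((2 * c + d) *: al + (c + 2 * d) *: be) = c * X + d * Y.
Proof.
have dotZr (r : R) x y : dot x (r *: y) = r * dot x y.
  by rewrite dotC dotZl dotC.
by rewrite /point !dotE !dotZr !dotE; field.
Qed.

End Hull.

(** * The hull of the corner alcoves *)

Definition occupied (S : set W) (X Y : int) : Prop :=
  exists2 w, S w & xcoord (pos w) = X /\ ycoord (pos w) = Y.

Lemma alcove_hull_hexagon (R : realType) (D : simple_roots R) (S : set W)
    (x0 x1 y0 y1 z0 z1 : int) v :
  (forall w, S w -> hexagon x0 x1 y0 y1 z0 z1 (xcoord (pos w)) (ycoord (pos w))) ->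
  occupied S x1 y1 -> occupied S (z0 + y1) y1 -> occupied S x0 (x0 - z0) ->
  occupied S x0 y0 -> occupied S (z1 + y0) y0 -> occupied S x1 (x1 - z1) ->
  alcove_hull D S v <-> hexagon x0 x1 y0 y1 z0 z1 (xcoord (pos v)) (ycoord (pos v)).
Proof.
move=> SH h1 h2 h3 h4 h5 h6; split.
  move=> hv.
  (* A half-plane bound on the barycentres of [S] passes to their hull; the pairs [(c, d)] below run
     through the six sides. *)
  have ge (c d k : int) :
      (forall w, S w -> k <= c * xcoord (pos w) + d * ycoord (pos w)) ->
      k <= c * xcoord (pos v) + d * ycoord (pos v).
    move=> kS; rewrite -(ler_int R) rmorphD !rmorphM /= -(point_dot D) -barycentre_point.
    apply: hull_dot_ge hv => _ [w Sw <-].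
    by rewrite barycentre_point point_dot -!rmorphM -rmorphD ler_int kS.
  have b0 : x0 <= 1 * xcoord (pos v) + 0 * ycoord (pos v).
    by apply: ge => w /SH; rewrite /hexagon; lia.
  have b1 : (- x1) <= (-1) * xcoord (pos v) + 0 * ycoord (pos v).
    by apply: ge => w /SH; rewrite /hexagon; lia.
  have b2 : y0 <= 0 * xcoord (pos v) + 1 * ycoord (pos v).
    by apply: ge => w /SH; rewrite /hexagon; lia.
  have b3 : (- y1) <= 0 * xcoord (pos v) + (-1) * ycoord (pos v).
    by apply: ge => w /SH; rewrite /hexagon; lia.
  have b4 : z0 <= 1 * xcoord (pos v) + (-1) * ycoord (pos v).
    by apply: ge => w /SH; rewrite /hexagon; lia.
  have b5 : (- z1) <= (-1) * xcoord (pos v) + 1 * ycoord (pos v).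
    by apply: ge => w /SH; rewrite /hexagon; lia.
  by rewrite /hexagon; lia.
move=> /and3P [hX hY hZ].
have occ X Y : occupied S X Y -> hull (barycentre D @` S) (point D X%:~R Y%:~R).
  by case=> w Sw [<- <-]; apply: hull_sub; exists w => //; apply: barycentre_point.
rewrite /alcove_hull /= barycentre_point.
apply: (@hull_hexagon _ _ _ x0%:~R x1%:~R y0%:~R y1%:~R z0%:~R z1%:~R);
  rewrite -?intrD -?intrB ?ler_int //; exact: occ.
Qed.

Unset Implicit Arguments.

Theorem proposition6p1 (R : realType) (D : simple_roots R) (n m : int) :
  2 <= n -> 1 <= m ->
  Sh (a n m) = alcove_hull D
    [set a n m;
         a (3 - n + eps n) (n + m - 3 + eps n);
         a (3 - n - m - eps n + eps m) (n - 2 - eps n - eps m);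
         a (n + 1) (m - 2);
         a (2 - n - eps n) (n + m - 1 - eps n);
         a (2 - n - m - eps n + eps m) (n - eps n - eps m)].
Proof.
move=> n2 m1; set S := [set _; _; _; _; _; _].
have epsE (k : int) : eps k = (k %% 2)%Z by rewrite /eps; case: ifP; lia.
have SH w : S w -> hexagon_a n m (xcoord (pos w)) (ycoord (pos w)).
  have aH (n' m' : int) : hexagon_a n m (n' + 1 + (m' %/ 2)%Z) (((n' + 1) %/ 2)%Z + 1 +
      (if (n' %% 2)%Z == 0 then - ((m' + 1) %/ 2)%Z else m')) ->
      hexagon_a n m (xcoord (pos (a n' m'))) (ycoord (pos (a n' m'))).
    by have [-> ->] := pos_a n' m'.
  rewrite /S /= !epsE => Sw.
  by case: Sw => [[[[[->|->]|->]|->]|->]|->]; apply: aH; rewrite /hexagon_a /hexagon;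
    case: ifP => /eqP ?; lia.
have occ (n' m' X Y : int) : S (a n' m') -> n' + 1 + (m' %/ 2)%Z = X ->
    ((n' + 1) %/ 2)%Z + 1 +
      (if (n' %% 2)%Z == 0 then - ((m' + 1) %/ 2)%Z else m') = Y ->
    occupied S X Y.
  by move=> Sa eX eY; exists (a n' m') => //; have [-> ->] := pos_a n' m'.
have [S1 S2 S3] : [/\ S (a n m), S (a (3 - n + eps n) (n + m - 3 + eps n)) &
    S (a (3 - n - m - eps n + eps m) (n - 2 - eps n - eps m))].
  by rewrite /S /=; split; tauto.
have [S4 S5 S6] : [/\ S (a (n + 1) (m - 2)),
    S (a (2 - n - eps n) (n + m - 1 - eps n)) &
    S (a (2 - n - m - eps n + eps m) (n - eps n - eps m))].
  by rewrite /S /=; split; tauto.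
rewrite !epsE in S2 S3 S5 S6.
suff hH v : alcove_hull D S v <-> hexagon_a n m (xcoord (pos v)) (ycoord (pos v)).
  by apply/seteqP; split=> v /=;
    [move/(Sh_hexagon _ n2 m1)/hH|move/hH/(Sh_hexagon _ n2 m1)].
apply: alcove_hull_hexagon SH _ _ _ _ _ _.
(* On the side [X = x1], for even [n], [a (n + 1) (m - 2)] is the corner with greatest [Y] and
   [a n m] the one with least; for odd [n] they change places. *)
- case: (eqVneq (n %% 2)%Z 0) => ?; [apply: (occ _ _ _ _ S4)|apply: (occ _ _ _ _ S1)];
  try case: ifP => /eqP ?; lia.
- apply: (occ _ _ _ _ S2); try case: ifP => /eqP ?; lia.
- apply: (occ _ _ _ _ S3); try case: ifP => /eqP ?; lia.
- apply: (occ _ _ _ _ S6); try case: ifP => /eqP ?; lia.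
- apply: (occ _ _ _ _ S5); try case: ifP => /eqP ?; lia.
- case: (eqVneq (n %% 2)%Z 0) => ?; [apply: (occ _ _ _ _ S1)|apply: (occ _ _ _ _ S4)];
  try case: ifP => /eqP ?; lia.
Qed.
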